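(* There exist an Archimedean vector lattice $X$, an Archimedean pre-Riesz space $Z$ and a linear operator $T\in L(X,Z)\cap L_{oc}(X,Z^\delta)$ such that $T\notin L_{oc}(X,Z)$.
   Context: All vector spaces are real. An ordered vector space is a real vector space $X$ with a cone $X_+$ (closed under nonnegative linear combinations, with $X_+\cap(-X_+)=\{0\}$), ordered by $x\le y$ iff $y-x\in X_+$. It is Archimedean if for all $x,y\in X$ with $nx\le y$ for every $n\in\mathbb{N}$ one has $x\le 0$. A linear map $i\colon X\to Y$ between ordered vector spaces is bipositive if for every $x\in X$: $i(x)\ge 0$ iff $x\ge 0$. A linear subspace $D$ of an ordered vector space $Y$ is order dense in $Y$ if for every $y\in Y$ the infimum of $\{z\in D : y\le z\}$ exists in $Y$ and equals $y$. An ordered vector space $Z$ is a pre-Riesz space if there exist a vector lattice $Y$ and a bipositive linear map $i\colon Z\to Y$ such that $i(Z)$ is order dense in $Y$. For an Archimedean pre-Riesz space $Z$, $Z^\delta$ denotes its Dedekind completion: the (unique up to order isomorphism) Dedekind complete vector lattice containing $Z$ as an order dense subspace. Operators into $Z$ are viewed as operators into $Z^\delta$ via the inclusion $Z\subseteq Z^\delta$. For a net, $z_\alpha\downarrow 0$ means that $\alpha\le\beta$ implies $z_\alpha\ge z_\beta$ and $\inf_\alpha z_\alpha=0$. A net $(x_\alpha)_\alpha$ in $X$ order converges to $x\in X$ if there is a net $(z_\alpha)_\alpha$ in $X$ (with the same index set) such that $z_\alpha\downarrow 0$ and $\pm(x-x_\alpha)\le z_\alpha$ for every $\alpha$. A linear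 operator $T\colon X\to Z$ is order continuous if for every net $(x_\alpha)_\alpha$ in $X$ that order converges to some $x\in X$, the net $(T(x_\alpha))_\alpha$ order converges to $T(x)$ in $Z$. $L(X,Z)$ is the vector space of all linear operators from $X$ to $Z$, and $L_{oc}(X,Z)$ the set of all order continuous ones. *)

(* Defs.v *)
From HB Require Import structures.
From mathcomp Require Import all_boot all_order all_algebra.
From mathcomp Require Import boolp classical_sets reals.

Set Implicit Arguments.
Unset Strict Implicit.
Unset Printing Implicit Defensive.

Import Order.TTheory GRing.Theory Num.Theory.

Local Open Scope classical_set_scope.
Local Open Scope ring_scope.

(* The cone is [set x | 0 <= x]; it is pointed because <= is antisymmetric. *)
HB.mixin Record isOrderedLmodule (R : numDomainType) X
    of Num.POrderedZmodule X & GRing.Lmodule R X := {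
  cone_comb : forall (a b : R) (x y : X),
    0 <= a -> 0 <= b -> 0 <= x -> 0 <= y -> 0 <= a *: x + b *: y;
  le_cone : forall x y : X, (x <= y) = (0 <= y - x)
}.

#[short(type="orderedLmodType")]
HB.structure Definition OrderedLmodule (R : numDomainType) :=
  { X of isOrderedLmodule R X & Num.POrderedZmodule X & GRing.Lmodule R X }.

(* supremums A and infimums A are the sets of least upper bounds and of greatest
   lower bounds of A; each is either empty or a singleton. *)
Definition vector_lattice (R : numDomainType) (X : orderedLmodType R) : Prop :=
  forall x y : X,
    supremums [set x; y] !=set0 /\ infimums [set x; y] !=set0.

Definition archimedean (R : numDomainType) (X : orderedLmodType R) : Prop :=
  forall x y : X, (forall n : nat, x *+ n <= y) -> x <= 0.

Definition bipositive (R : numDomainType) (X Y : orderedLmodType R)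
    (i : {linear X -> Y}) : Prop :=
  forall x : X, 0 <= i x <-> 0 <= x.

Definition order_dense (R : numDomainType) (Y : orderedLmodType R)
    (D : set Y) : Prop :=
  forall y : Y, infimums [set z | D z /\ y <= z] y.

Definition pre_Riesz (R : numDomainType) (Z : orderedLmodType R) : Prop :=
  exists (Y : orderedLmodType R) (i : {linear Z -> Y}),
    [/\ vector_lattice Y, bipositive i & order_dense (range i)].

Definition Dedekind_complete (R : numDomainType) (Y : orderedLmodType R) : Prop :=
  forall A : set Y, A !=set0 -> ubound A !=set0 -> supremums A !=set0.

(* The inclusion of Z into its completion is represented by a bipositive
   (hence injective) linear map j. *)
Definition is_Dedekind_completion (R : numDomainType) (Z Y : orderedLmodType R)
    (j : {linear Z -> Y}) : Prop :=
  [/\ vector_lattice Y, Dedekind_complete Y, bipositive j & order_dense (range j)].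

Definition directed (I : Type) (le : I -> I -> Prop) : Prop :=
  [/\ inhabited I,
      forall a, le a a,
      forall a b c, le a b -> le b c -> le a c &
      forall a b, exists c, le a c /\ le b c].

Definition decreases_to_0 (R : numDomainType) (X : orderedLmodType R)
    (I : Type) (le : I -> I -> Prop) (z : I -> X) : Prop :=
  (forall a b, le a b -> z b <= z a) /\ infimums (range z) 0.

Definition order_converges (R : numDomainType) (X : orderedLmodType R)
    (I : Type) (le : I -> I -> Prop) (u : I -> X) (x : X) : Prop :=
  exists z : I -> X, decreases_to_0 le z /\
    forall a, x - u a <= z a /\ - (x - u a) <= z a.

Definition order_continuous (R : numDomainType) (X Z : orderedLmodType R)
    (T : {linear X -> Z}) : Prop :=
  forall (I : Type) (le : I -> I -> Prop), directed le ->
  forall (u : I -> X) (x : X),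
    order_converges le u x -> order_converges le (fun a => T (u a)) (T x).

(* Main.v *)
(* Let X be the eventually constant sequences, Z the sequences that eventually
   equal (z 0 + z 1) / 2, and T x = (0, 0, x_0, x_1 - x_0, x_2 - x_1, ...).
   In Z every coordinate can be exposed, so Z is order dense in l^oo, which is
   therefore its Dedekind completion.  Infima of decreasing nets are pointwise in
   all three spaces; as T x is dominated by shifts of |x|, T is order continuous
   into l^oo.  The unit vectors e_n order converge to 0 in X, but a sequence w_n
   decreasing to 0 in Z has a member with (w_n 0 + w_n 1) / 2 < 1, hence is below 1
   at infinity and cannot dominate T e_n, which has a coordinate equal to 1. *)
Require Import Defs.
From HB Require Import structures.
From mathcomp Require Import all_boot all_order all_algebra.
From mathcomp Require Import boolp classical_sets reals.
From mathcomp Require Import functions ring lra zify.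

Set Implicit Arguments.
Unset Strict Implicit.
Unset Printing Implicit Defensive.

Import Order.TTheory GRing.Theory Num.Theory.

Local Open Scope classical_set_scope.
Local Open Scope ring_scope.

(** * Sequence spaces with the coordinatewise order *)

Section SequenceSpaces.
Variable R : realType.

(* Only the regular module R^o makes nat -> R^o a module over R; [coord] brings
   the coordinates back to R, whose order lemmas then apply. *)
Record seqspace (D : submodClosed (nat -> R^o)) :=
  SeqSpace { seqval : nat -> R^o; seqvalP : seqval \in D }.

Definition coord D (x : seqspace D) : nat -> R := seqval x.
Coercion coord : seqspace >-> Funclass.

Section Structure.
Variable D : submodClosed (nat -> R^o).

HB.instance Definition _ := [isSub for @seqval D].
HB.instance Definition _ := [Choice of seqspace D by <:].
HB.instance Definition _ := [SubChoice_isSubLmodule of seqspace D by <:].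

Lemma coord_inj (x y : seqspace D) : x =1 y -> x = y.
Proof. by move=> xy; apply/val_inj/funext. Qed.

Lemma coord0 n : (0 : seqspace D) n = 0. Proof. by []. Qed.

Lemma coordD (x y : seqspace D) n : (x + y) n = x n + y n.
Proof. by []. Qed.

Lemma coordN (x : seqspace D) n : (- x) n = - x n. Proof. by []. Qed.

Lemma coordZ a (x : seqspace D) n : (a *: x) n = a * x n. Proof. by []. Qed.

Lemma coordMn (x : seqspace D) k n : (x *+ k) n = x n *+ k.
Proof. by elim: k => // k IH; rewrite !mulrS coordD IH. Qed.

Definition coordE := (coord0, coordD, coordN, coordZ, coordMn).

Definition seq_le (x y : seqspace D) : bool := `[< forall n, x n <= y n >].

Lemma seq_le_refl : reflexive seq_le.
Proof. by move=> x; apply/asboolP. Qed.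

Lemma seq_le_anti : antisymmetric seq_le.
Proof.
move=> x y /andP[/asboolP xy /asboolP yx]; apply/coord_inj => n /=.
by apply/le_anti; rewrite xy yx.
Qed.

Lemma seq_le_trans : transitive seq_le.
Proof.
move=> y x z /asboolP xy /asboolP yz; apply/asboolP => n.
exact: le_trans (xy n) (yz n).
Qed.

HB.instance Definition _ := Order.Le_isPOrder.Build ring_display (seqspace D)
  seq_le_refl seq_le_anti seq_le_trans.

Lemma seq_leP (x y : seqspace D) : (x <= y) <-> (forall n, x n <= y n).
Proof. by split => [/asboolP|h]; [|apply/asboolP]. Qed.

Lemma seq_cone_comb (a b : R) (x y : seqspace D) :
  0 <= a -> 0 <= b -> 0 <= x -> 0 <= y -> 0 <= a *: x + b *: y.
Proof.
move=> a0 b0 /seq_leP x0 /seq_leP y0; apply/seq_leP => n.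
by rewrite !coordE addr_ge0 ?mulr_ge0 ?x0 ?y0.
Qed.

Lemma seq_le_cone (x y : seqspace D) : (x <= y) = (0 <= y - x).
Proof.
by apply/idP/idP => /seq_leP h; apply/seq_leP => n; have := h n;
  rewrite !coordE subr_ge0.
Qed.

HB.instance Definition _ := isOrderedLmodule.Build R (seqspace D)
  seq_cone_comb seq_le_cone.

Lemma seqspace_archimedean : archimedean (seqspace D).
Proof.
move=> x y xy; apply/seq_leP => s; rewrite leNgt; apply/negP => xs0.
have := archi_boundP (normr_ge0 (y s / x s)).
set n := Num.bound _ => /(le_lt_trans (ler_norm _)).
rewrite ltr_pdivrMr // mulrC mulr_natr => lt_n.
have /seq_leP/(_ s) := xy n; rewrite coordE => le_n.
by have := lt_le_trans lt_n le_n; rewrite ltxx.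
Qed.

(** Maxima suffice: the pointwise minimum is [x + y - M], which a linear subspace contains along
    with [M]. *)
Lemma seqspace_lattice :
  (forall x y : seqspace D, (fun n => Num.max (x n) (y n) : R^o) \in D) ->
  vector_lattice (seqspace D).
Proof.
move=> maxD x y; pose M := SeqSpace (maxD x y).
have ME n : M n = Num.max (x n) (y n) by [].
have mE n : (x + y - M) n = Num.min (x n) (y n).
  rewrite !coordE ME; have := addr_max_min (x n) (y n); lra.
split.
- exists M; split.
  + by move=> z [->|->]; apply/seq_leP => n; rewrite ME le_max lexx ?orbT.
  + move=> z zub; apply/seq_leP => n; rewrite ME ge_max.
    by apply/andP; split; apply/seq_leP: n; apply: zub; [left|right].
- exists (x + y - M); split.
  + by move=> z [->|->]; apply/seq_leP => n; rewrite mE ge_min lexx ?orbT.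
  + move=> z zlb; apply/seq_leP => n; rewrite mE le_min.
    by apply/andP; split; apply/seq_leP: n; apply: zlb; [left|right].
Qed.

(** * Infima and coordinates *)

Lemma infimums_coord (A : set (seqspace D)) (z : seqspace D) :
  lbound A z -> (forall n e, 0 < e -> exists2 a, A a & a n <= z n + e) ->
  infimums A z.
Proof.
move=> zlb Az; split=> // w wlb; apply/seq_leP => n; apply/ler_addgt0Pr => e e0.
have [a Aa an] := Az n e e0.
by apply: le_trans an; apply/seq_leP: n; exact: wlb.
Qed.

(* Multiples of such a w are lower bounds of every set of positive elements
   bounded away from 0 at n, and M - c w exposes the coordinate n. *)
Definition peaking :=
  forall n, exists w : seqspace D, w n = 1 /\ forall k, k != n -> w k <= 0.

(** If the net did not fall below [e] at [n], monotonicity would keep all its members at least [e]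
    there, and [e *: w] would be a lower bound that is positive at [n]. *)
Lemma decreases_to_0_coord (I : Type) (le : I -> I -> Prop)
    (z : I -> seqspace D) :
  peaking -> decreases_to_0 le z ->
  (forall a n, 0 <= z a n) /\
  (forall n e, 0 < e -> exists a, forall b, le a b -> z b n < e).
Proof.
move=> pk [dec [z0 zinf]].
have zge0 a n : 0 <= z a n.
  by have /seq_leP := z0 (z a) (ex_intro2 _ _ a Logic.I erefl); apply.
split=> // n e e0; apply: contrapT => /forallNP nz.
have zn a : e <= z a n.
  have /existsNP[b /not_implyP[ab /negP]] := nz a; rewrite -leNgt => ezb.
  by apply: le_trans ezb _; have /seq_leP := dec _ _ ab; apply.
have [w [wn wk]] := pk n.
have /seq_leP/(_ n) : e *: w <= 0.
  apply: zinf => _ [a _ <-]; apply/seq_leP => k; rewrite coordE.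
  have [->|kn] := eqVneq k n; first by rewrite wn mulr1.
  by apply: le_trans (zge0 a k); rewrite pmulr_rle0 // wk.
by rewrite !coordE wn mulr1 leNgt e0.
Qed.

End Structure.

(** * The three sequence spaces *)

Definition ev_constant : {pred nat -> R^o} :=
  fun f : nat -> R => `[< exists N, forall n, (N <= n)%N -> f n = f N >].

Definition ev_average : {pred nat -> R^o} :=
  fun f : nat -> R =>
    `[< exists N, forall n, (N <= n)%N -> f n = 2^-1 * (f 0%N + f 1%N) >].

Definition seq_bounded : {pred nat -> R^o} :=
  fun f : nat -> R => `[< exists M : R, forall n, `|f n| <= M >].

Lemma ev_constant_closed : subsemimod_closed ev_constant.
Proof.
split; [split|].
- by apply/asboolP; exists 0%N.
- move=> f g /asboolP[N fN] /asboolP[K gK]; apply/asboolP; exists (N + K)%N => n.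
  move=> len; have [Nn Kn] : (N <= n /\ K <= n)%N by lia.
  have fE : f n = f (N + K)%N by rewrite fN // [RHS]fN ?leq_addr.
  have gE : g n = g (N + K)%N by rewrite gK // [RHS]gK ?leq_addl.
  by rewrite [LHS]/((f n : R) + g n) fE gE.
- move=> a f /asboolP[N fN]; apply/asboolP; exists N => n len.
  by have fE : a * (f n : R) = a * f N by rewrite (fN n len).
Qed.

HB.instance Definition _ :=
  GRing.isSubmodClosed.Build R (nat -> R^o) ev_constant ev_constant_closed.

Lemma ev_average_closed : subsemimod_closed ev_average.
Proof.
split; [split|].
- by apply/asboolP; exists 0%N => n _; rewrite addr0 mulr0.
- move=> f g /asboolP[N fN] /asboolP[K gK]; apply/asboolP; exists (N + K)%N => n.
  move=> len; have [Nn Kn] : (N <= n /\ K <= n)%N by lia.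
  have key a b c d :
      2^-1 * (a + b) + 2^-1 * (c + d) = 2^-1 * ((a + c) + (b + d)) :> R.
    by ring.
  by rewrite [LHS]/((f n : R) + g n) (fN n Nn) (gK n Kn); exact: key.
- move=> a f /asboolP[N fN]; apply/asboolP; exists N => n len.
  have key b c d : b * (2^-1 * (c + d)) = 2^-1 * (b * c + b * d) :> R by ring.
  by rewrite [LHS]/(a * (f n : R)) (fN n len); exact: key.
Qed.

HB.instance Definition _ :=
  GRing.isSubmodClosed.Build R (nat -> R^o) ev_average ev_average_closed.

Lemma seq_bounded_closed : subsemimod_closed seq_bounded.
Proof.
split; [split|].
- by apply/asboolP; exists 0 => n; rewrite normr0.
- move=> f g /asboolP[M fM] /asboolP[K gK]; apply/asboolP; exists (M + K) => n.
  exact: le_trans (ler_normD _ _) (lerD (fM n) (gK n)).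
- move=> a f /asboolP[M fM]; apply/asboolP; exists (`|a| * M) => n.
  by rewrite [X in `|X|]/(a * f n) normrM ler_wpM2l.
Qed.

HB.instance Definition _ :=
  GRing.isSubmodClosed.Build R (nat -> R^o) seq_bounded seq_bounded_closed.

Lemma ev_constant_bounded : {subset ev_constant <= seq_bounded}.
Proof.
move=> f /asboolP[N fN]; apply/asboolP.
(* All values of [f] occur among the indices up to [N], so this finite sum exceeds each of them in
   absolute value. *)
exists (\sum_(i < N.+1) `|f i|) => n.
have [k ->] : exists k : 'I_N.+1, f n = f k.
  have [nN|Nn] := ltnP n N.+1; first by exists (Ordinal nN).
  by exists ord_max; apply: fN; lia.
by rewrite (bigD1 k) //= lerDl sumr_ge0.
Qed.

Lemma ev_average_constant : {subset ev_average <= ev_constant}.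
Proof.
move=> f /asboolP[N fN]; apply/asboolP; exists N => n len.
by rewrite (fN n) // (fN N).
Qed.

Lemma ev_average_bounded : {subset ev_average <= seq_bounded}.
Proof. by move=> f /ev_average_constant/ev_constant_bounded. Qed.

(** * Inclusions and order density *)

Section Inclusion.
Variables D E : submodClosed (nat -> R^o).
Hypothesis DE : {subset D <= E}.

Definition seq_incl (x : seqspace D) : seqspace E := SeqSpace (DE (seqvalP x)).

Lemma seq_incl_linear : linear seq_incl.
Proof. by move=> a x y; apply: coord_inj. Qed.

HB.instance Definition _ :=
  GRing.isLinear.Build R (seqspace D) (seqspace E) *:%R seq_incl seq_incl_linear.

Lemma seq_incl_bipositive : bipositive seq_incl.
Proof. by move=> x; split => /seq_leP h; apply/seq_leP => n; exact: h. Qed.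

Lemma seq_incl_order_dense :
  (forall c : R, (fun=> c : R^o) \in D) -> {subset E <= seq_bounded} ->
  peaking D -> order_dense (range seq_incl).
Proof.
move=> cD Eb pk y; apply: infimums_coord => [z [_]//|n e e0].
have /asboolP[M yM] := Eb _ (seqvalP y).
have {}yM k : y k <= M by apply: le_trans (yM k); exact: ler_norm.
have [w [wn wk]] := pk n.
have cE k : SeqSpace (cD M) k = M by [].
(* The factor [M - y n] makes [z] agree with [y] at [n]. It is nonnegative and [w] is nonpositive
   elsewhere, so there [z] stays above [M], hence above [y]. *)
pose z := SeqSpace (cD M) - (M - y n) *: w.
have zE k : seq_incl z k = M - (M - y n) * w k.
  by rewrite -[LHS]/(z k) !coordE cE.
exists (seq_incl z); last by rewrite zE wn mulr1 subKr lerDl ltW.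
split; first by exists z.
apply/seq_leP => k; rewrite zE; have [->|kn] := eqVneq k n.
  by rewrite wn mulr1 subKr.
apply: le_trans (yM k) _.
by rewrite lerDl oppr_ge0 mulr_ge0_le0 ?wk ?subr_ge0.
Qed.

End Inclusion.

(** * Completeness, lattice operations and peaks *)

Lemma seq_bounded_complete : Dedekind_complete (seqspace seq_bounded).
Proof.
move=> A [a Aa] [b bub]; pose An n := [set x n | x in A].
have hs n : has_sup (An n).
  split; first by exists (a n), a.
  by exists (b n) => _ [x Ax <-]; apply/seq_leP: n; exact: bub.
have ubs x n : A x -> x n <= sup (An n).
  by move=> Ax; apply: (ub_le_sup (hs n).2); exists x.
have sle z n : ubound A z -> sup (An n) <= z n.
  move=> zub; apply: (ge_sup (hs n).1) => _ [x Ax <-].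
  by apply/seq_leP: n; exact: zub.
have sb : (fun n => sup (An n) : R^o) \in seq_bounded.
  have /asboolP[M aM] := seqvalP a; have /asboolP[K bK] := seqvalP b.
  (* The supremum at [n] lies between [a n >= - M] and [b n <= K], and [M] and [K] are
     nonnegative. *)
  apply/asboolP; exists (M + K) => n.
  have M0 : 0 <= M := le_trans (normr_ge0 _) (aM n).
  have K0 : 0 <= K := le_trans (normr_ge0 _) (bK n).
  have : `|a n| <= M := aM n; have : `|b n| <= K := bK n.
  have := ubs a n Aa; have := sle b n bub; rewrite !ler_norml.
  move=> h1 h2 /andP[h3 h4] /andP[h5 h6].
  by apply/andP; split; lra.
exists (SeqSpace sb); split=> [x Ax|z zub]; apply/seq_leP => n.
  exact: ubs.
exact: sle.
Qed.

Lemma ev_constant_lattice : vector_lattice (seqspace ev_constant).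
Proof.
apply: seqspace_lattice => x y.
have /asboolP[N xN] := seqvalP x; have /asboolP[K yK] := seqvalP y.
apply/asboolP; exists (N + K)%N => n len.
have [Nn Kn] : (N <= n /\ K <= n)%N by lia.
have -> : x n = x (N + K)%N by rewrite /coord xN // [RHS]xN ?leq_addr.
by have -> : y n = y (N + K)%N by rewrite /coord yK // [RHS]yK ?leq_addl.
Qed.

Lemma seq_bounded_lattice : vector_lattice (seqspace seq_bounded).
Proof.
apply: seqspace_lattice => x y.
have /asboolP[M xM] := seqvalP x; have /asboolP[K yK] := seqvalP y.
apply/asboolP; exists (Num.max M K) => n.
by rewrite le_max; have [_|_] := leP (x n) (y n); rewrite ?xM ?yK ?orbT.
Qed.

Lemma ev_constant_peaking : peaking ev_constant.
Proof.
move=> n; have dP : (fun k => (k == n)%:R : R^o) \in ev_constant.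
  by apply/asboolP; exists n.+1 => k nk; rewrite !gtn_eqF.
exists (SeqSpace dP); split=> [|k kn]; rewrite /coord /=; first by rewrite eqxx.
by rewrite (negPf kn).
Qed.

Lemma ev_average_peaking : peaking ev_average.
Proof.
move=> n.
(* For n < 2 the other one of the two averaged coordinates gets the value -1. *)
pose d k : R := (k == n)%:R - ((n < 2) && (k == 1 - n))%N%:R.
have dn : d n = 1.
  by rewrite /d eqxx; case: (n) => [|[|m]] /=; rewrite subr0.
have d0 k : k != n -> d k <= 0.
  by move=> /negPf kn; rewrite /d kn sub0r oppr_le0 ler0n.
(* With average 0, finite support is enough for membership in [ev_average]. *)
have d01 : d 0%N + d 1%N = 0.
  by rewrite /d; case: (n) => [|[|m]] //=; lra.
have dP : (d : nat -> R^o) \in ev_average.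
  apply/asboolP; exists n.+2 => k nk; rewrite d01 mulr0 /d gtn_eqF; last lia.
  have -> : (k == 1 - n)%N = false by lia.
  by rewrite andbF subr0.
by exists (SeqSpace dP).
Qed.

(** * The difference operator *)

Definition shifted_diff (x : nat -> R) : nat -> R^o :=
  fun n => if n is k.+2 then x k - (if k is l.+1 then x l else 0) else 0.

(** The two leading zeros have average 0, and the differences of an eventually constant sequence are
    eventually 0. Entry [n.+3] is [x n.+1 - x n], whence the threshold [N.+3]. *)
Lemma shifted_diffP (x : seqspace ev_constant) : shifted_diff x \in ev_average.
Proof.
have /asboolP[N xN] := seqvalP x.
apply/asboolP; exists N.+3 => -[|[|[|n]]] //= nN.
by rewrite addr0 mulr0 /coord (xN n.+1) ?(xN n) ?subrr //; lia.
Qed.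

Definition diff_op (x : seqspace ev_constant) : seqspace ev_average :=
  SeqSpace (shifted_diffP x).

Lemma diff_opE x n : diff_op x n = shifted_diff x n. Proof. by []. Qed.

Lemma diff_op_linear : linear diff_op.
Proof.
move=> a x y; apply: coord_inj => n; rewrite coordD coordZ !diff_opE.
case: n => [|[|[|n]]]; rewrite /shifted_diff ?coordE; lra.
Qed.

HB.instance Definition _ := GRing.isLinear.Build R (seqspace ev_constant)
  (seqspace ev_average) *:%R diff_op diff_op_linear.

(** Triangle inequality for a difference of two neighbours. For [n <= 2] truncated subtraction makes
    both indices 0, which is harmless as [z] is nonnegative. *)
Lemma diff_op_le (u z : seqspace ev_constant) n :
  (forall k, `|u k| <= z k) -> `|diff_op u n| <= z (n - 2)%N + z (n - 3)%N.
Proof.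
move=> uz; have z0 k : 0 <= z k := le_trans (normr_ge0 _) (uz k).
rewrite diff_opE /shifted_diff; case: n => [|[|[|n]]] /=.
- by rewrite normr0 addr_ge0.
- by rewrite normr0 addr_ge0.
- by rewrite subr0 (le_trans (uz 0%N)) // lerDl.
- rewrite !subSS !subn0; apply: le_trans (ler_normB _ _) _.
  by rewrite lerD ?uz.
Qed.

Lemma diff_op_order_continuous_bounded :
  order_continuous (seq_incl ev_average_bounded \o diff_op).
Proof.
move=> I le [_ _ _ ledir] u x [z [zdec uz]].
have [z0 zlim] := decreases_to_0_coord ev_constant_peaking zdec.
(* The dominating net in the completion: its members are bounded but need not lie in
   [ev_average]. *)
have wP a : (fun n => z a (n - 2)%N + z a (n - 3)%N : R^o) \in seq_bounded.
  have /asboolP[M zM] := ev_constant_bounded (seqvalP (z a)).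
  apply/asboolP; exists (M + M) => n.
  exact: le_trans (ler_normD _ _) (lerD (zM _) (zM _)).
have wE a n : SeqSpace (wP a) n = z a (n - 2)%N + z a (n - 3)%N by [].
exists (fun a => SeqSpace (wP a)); split; first split.
- move=> a b ab; apply/seq_leP => n; rewrite !wE.
  by have /seq_leP zba := zdec.1 a b ab; exact: lerD.
- apply: infimums_coord => [_ [a _ <-]|n e e0].
    by apply/seq_leP => n; rewrite wE coord0 addr_ge0.
  (* Half of [e] for each shifted term; directedness gives a common index. *)
  have e20 : 0 < e / 2 by rewrite divr_gt0.
  have [a za] := zlim (n - 2)%N _ e20; have [b zb] := zlim (n - 3)%N _ e20.
  have [c [ac bc]] := ledir a b.
  exists (SeqSpace (wP c)); first by exists c.
  by rewrite wE coord0 add0r [leRHS]splitr lerD // ltW ?za ?zb.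
- move=> a; have xz k : `|(x - u a) k| <= z a k.
    have [/seq_leP/(_ k) h1 /seq_leP/(_ k) h2] := uz a.
    by rewrite ler_norml -lerNl h1 -coordN h2.
  rewrite -raddfB; set v := _ (x - u a).
  have vz n : `|v n| <= SeqSpace (wP a) n by rewrite wE; exact: diff_op_le.
  split; apply/seq_leP => n; apply: le_trans (vz n); rewrite ?coordN.
    exact: ler_norm.
  by rewrite -normrN ler_norm.
Qed.

Lemma diff_op_not_order_continuous : ~ order_continuous diff_op.
Proof.
have dP m : (fun n => (n == m)%:R : R^o) \in ev_constant.
  by apply/asboolP; exists m.+1 => n mn; rewrite !gtn_eqF.
(* Indicators of tails dominate the unit vectors and decrease to 0, since [t n.+1] vanishes at
   [n]. *)
have tP m : (fun n => (m <= n)%N%:R : R^o) \in ev_constant.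
  by apply/asboolP; exists m => n ->; rewrite leqnn.
pose d m := SeqSpace (dP m); pose t m := SeqSpace (tP m).
have dE m n : d m n = (n == m)%:R by [].
have tE m n : t m n = (m <= n)%N%:R by [].
have dir : directed (fun m n : nat => (m <= n)%N).
  split=> [|//|a b c|a b]; [exact: inhabits 0%N | exact: leq_trans|].
  by exists (a + b)%N; rewrite leq_addr leq_addl.
have dcvg : order_converges (fun m n : nat => (m <= n)%N) d 0.
  exists t; split; first split.
  - move=> a b ab; apply/seq_leP => n; rewrite !tE ler_nat.
    by case: (leqP b n) => // bn; rewrite (leq_trans ab bn).
  - apply: infimums_coord => [_ [a _ <-]|n e e0].
      by apply/seq_leP => n; rewrite tE coord0 ler0n.
    exists (t n.+1); first by exists n.+1.
    by rewrite tE ltnn coord0 add0r ltW.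
  - move=> a; split; apply/seq_leP => n; rewrite sub0r ?opprK ?coordN tE dE.
      by apply: le_trans (ler0n _ _); rewrite oppr_le0 ler0n.
    by rewrite ler_nat; case: eqP => // ->; rewrite leqnn.
move=> /(_ nat _ dir d 0 dcvg)[w [wdec dw]].
have [w0 wlim] := decreases_to_0_coord ev_average_peaking wdec.
(* The image of the unit vector [d m] jumps up to 1 at [m.+2]. *)
have w1 m : 1 <= w m m.+2.
  have [_ /seq_leP/(_ m.+2)] := dw m.
  rewrite linear0 sub0r opprK; apply: le_trans.
  rewrite diff_opE /shifted_diff dE eqxx.
  by case: (m) => [|k]; rewrite ?dE ?ltn_eqF // subr0.
have [a wa] := wlim 0%N 1 ltr01; have [b wb] := wlim 1%N 1 ltr01.
pose c := (a + b)%N.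
have /asboolP[N wN] := seqvalP (w c).
(* Along w c the limit is the average of two numbers below 1. *)
have : w c (c + N).+2 < 1.
  rewrite /coord wN; last lia.
  have := wa c (leq_addr _ _); have := wb c (leq_addl _ _); rewrite /coord; lra.
(* The later member [w (c + N)] is at least 1 at this coordinate, and [w c] dominates it. *)
apply/negP; rewrite -leNgt; apply: le_trans (w1 (c + N)%N) _.
by have /seq_leP := wdec.1 c (c + N)%N (leq_addr _ _); apply.
Qed.

End SequenceSpaces.

Theorem mainTheorem3 (R : realType) :
  exists (X Z Zd : orderedLmodType R) (j : {linear Z -> Zd}) (T : {linear X -> Z}),
    vector_lattice X /\ archimedean X /\ archimedean Z /\ pre_Riesz Z /\
    is_Dedekind_completion j /\
    order_continuous (j \o T) /\
    ~ order_continuous T.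
Proof.
pose j : {linear _ -> _} := seq_incl (@ev_average_bounded R).
have jd : order_dense (range j).
  apply: seq_incl_order_dense => // [c|]; last exact: ev_average_peaking.
  by apply/asboolP; exists 0%N => n _; lra.
have jp : bipositive j := seq_incl_bipositive _.
have jl := @seq_bounded_lattice R.
exists (seqspace (@ev_constant R)), (seqspace (@ev_average R)).
exists (seqspace (@seq_bounded R)), j, (@diff_op R).
split; first exact: ev_constant_lattice.
do 2![split; first exact: seqspace_archimedean].
(* The Dedekind completion also serves as the vector lattice witnessing that [Z] is pre-Riesz. *)
split; first by exists (seqspace (@seq_bounded R)), j.
split; first by split=> //; exact: seq_bounded_complete.
split; first exact: diff_op_order_continuous_bounded.
exact: diff_op_not_order_continuous.
Qed.
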